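(* Let $A_1=P_1J_1P_1^{-1}$ with $J_1=\begin{pmatrix}-n_1&1\\0&-n_1\end{pmatrix}$, $n_1>0$, and $A_2=P_2J_2P_2^{-1}$ with $J_2=\mathrm{diag}(p_2,q_2)$, where either $0<p_2\le q_2$ or $p_2\le0<q_2$; here $P_1,P_2$ are real invertible $2\times 2$ matrices chosen such that $M=P_2^{-1}P_1=\begin{pmatrix}a&b\\c&d\end{pmatrix}$ has determinant $1$ or $-1$. Given $\eta>0$, let $\tau_{1,2}(\eta)$ be the unique positive solution $t$ of $$n_1t-\ln\theta(t)=\left(\frac{p_2+q_2}{2}\right)\eta+\sinh^{-1}\left(\sqrt K\,\sinh\left(\frac{q_2-p_2}{2}\,\eta\right)\right),$$ where $K=\frac14\left(r^{-1}+r\right)^2$ with $r=\max\{2|ac|,1\}$. Then the switched system $\dot x(t)=A_{\sigma(t)}x(t)$ is stable for all $\sigma\in\mathcal S[\tau_{1,2}(\eta),\eta]$ and asymptotically stable for all $\sigma\in\mathcal S'[\tau_{1,2}(\eta),\eta]$.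
   Context: $\theta(t)=\left\|\begin{pmatrix}1&t\\0&1\end{pmatrix}\right\|=\sqrt{1+\frac{t^2}{2}+t\sqrt{1+\frac{t^2}{4}}}$ (spectral norm). Planar switched system: $\dot x(t)=A_{\sigma(t)}x(t)$, $x(t)\in\mathbb R^2$ continuous in $t\ge0$, with $A_1,A_2$ real $2\times2$ matrices. A switching signal $\sigma:[0,\infty)\to\{1,2\}$ is right-continuous and piecewise constant with infinitely many discontinuities $0<d_1<d_2<\cdots$, $d_k\to\infty$; set $d_0=0$. For a signal with $\sigma(0)=1$ put $t_k=d_{2k-1}-d_{2k-2}$ (times spent in $A_1$) and $s_k=d_{2k}-d_{2k-1}$ (times spent in $A_2$), $k\ge1$. For $\tau,\eta>0$, $\mathcal S[\tau,\eta]$ is the set of signals with $\sigma(0)=1$, $t_k\ge\tau$ and $s_k\le\eta$ for all $k\in\mathbb N$; $\mathcal S'[\tau,\eta]$ is the set of $\sigma\in\mathcal S[\tau,\eta]$ for which the sequence $(t_k,s_k)_{k\ge1}$ does not converge to $(\tau,\eta)$. For a given signal $\sigma$, the system is stable if for every $\varepsilon'>0$ there is $\delta>0$ such that $\|x(0)\|<\delta$ implies $\|x(t)\|<\varepsilon'$ for all $t>0$; it is asymptotically stable if it is stable and $\|x(t)\|\to0$ as $t\to\infty$ for every $x(0)\in\mathbb R^2$. Vector norms are Euclidean. *)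

(* Defs.v *)
From HB Require Import structures.
From mathcomp Require Import all_boot all_order all_algebra.
From mathcomp Require Import all_classical all_reals all_analysis.
From mathcomp Require Import ring lra.
Set Implicit Arguments.
Unset Strict Implicit.
Unset Printing Implicit Defensive.
Import Order.TTheory GRing.Theory Num.Theory.
Import numFieldNormedType.Exports.
Local Open Scope classical_set_scope.
Local Open Scope ring_scope.

Definition mx22 (R : realType) (a b c d : R) : 'M[R]_2 :=
  \matrix_(i < 2, j < 2) nth 0 (nth [::] [:: [:: a; b]; [:: c; d]] i) j.

(* The library norm on matrices is the sup norm, hence the explicit
   Euclidean and spectral norms below. *)
Definition enorm (R : realType) (x : 'cV[R]_2) : R :=
  Num.sqrt (\sum_(i < 2) x i 0 ^+ 2).

Definition spectral_norm (R : realType) (A : 'M[R]_2) : R :=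
  sup [set enorm (A *m x) | x in [set x : 'cV[R]_2 | enorm x <= 1]].

Definition theta (R : realType) (t : R) : R := spectral_norm (mx22 1 t 0 1).

Definition sinh (R : realType) (x : R) : R := (expR x - expR (- x)) / 2.

(* inverse of sinh, see sinhK and asinhK *)
Definition asinh (R : realType) (y : R) : R := ln (y + Num.sqrt (y ^+ 2 + 1)).

Inductive mode := mode1 | mode2.

Definition subsystem (R : realType) (A1 A2 : 'M[R]_2) (m : mode) : 'M[R]_2 :=
  match m with mode1 => A1 | mode2 => A2 end.

(* sigma, restricted to [0, +oo[, is right-continuous and piecewise constant,
   d 0 = 0, and its discontinuities are exactly d 1 < d 2 < ...  The values of
   sigma at negative times are irrelevant. *)
Definition switching_times (R : realType) (sigma : R -> mode) (d : nat -> R) :=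
  [/\ d 0%N = 0,
      forall k, d k < d k.+1,
      d k @[k --> \oo] --> +oo,
      forall k t, d k <= t < d k.+1 -> sigma t = sigma (d k) &
      forall k, sigma (d k.+1) <> sigma (d k)].

(* Cycles are numbered from 0: t_(k+1) is dwell1 d k, s_(k+1) is dwell2 d k. *)
Definition dwell1 (R : realType) (d : nat -> R) (k : nat) : R :=
  d (2 * k + 1)%N - d (2 * k)%N.
Definition dwell2 (R : realType) (d : nat -> R) (k : nat) : R :=
  d (2 * k + 2)%N - d (2 * k + 1)%N.

Definition dwell_bounds (R : realType) (tau eta : R) (sigma : R -> mode)
    (d : nat -> R) :=
  [/\ switching_times sigma d, sigma 0 = mode1 &
      forall k, tau <= dwell1 d k /\ dwell2 d k <= eta].

Definition signals (R : realType) (tau eta : R) : set (R -> mode) :=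
  [set sigma | exists d, dwell_bounds tau eta sigma d].

Definition signals' (R : realType) (tau eta : R) : set (R -> mode) :=
  [set sigma | exists2 d, dwell_bounds tau eta sigma d &
     ~ ((dwell1 d k, dwell2 d k) @[k --> \oo] --> ((tau, eta) : R * R))].

(* The differential equation is required at the times t > 0 where sigma is
   continuous, i.e. locally constant. *)
Definition solution (R : realType) (A1 A2 : 'M[R]_2) (sigma : R -> mode)
    (x : R -> 'cV[R]_2) :=
  {within `[0, +oo[%classic, continuous x} /\
  forall t : R, 0 < t -> (\forall u \near t, sigma u = sigma t) ->
    is_derive t 1 x (subsystem A1 A2 (sigma t) *m x t).

Definition stable (R : realType) (A1 A2 : 'M[R]_2) (sigma : R -> mode) :=
  forall eps : R, 0 < eps -> exists2 delta : R, 0 < delta &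
    forall x, solution A1 A2 sigma x -> enorm (x 0) < delta ->
      forall t, 0 < t -> enorm (x t) < eps.

Definition asymptotically_stable (R : realType) (A1 A2 : 'M[R]_2)
    (sigma : R -> mode) :=
  stable A1 A2 sigma /\
  forall x, solution A1 A2 sigma x -> enorm (x t) @[t --> +oo] --> (0 : R).

Definition is_tau12 (R : realType) (n1 p2 q2 eta K t : R) :=
  0 < t /\
  n1 * t - ln (theta t) =
    (p2 + q2) / 2 * eta + asinh (Num.sqrt K * sinh ((q2 - p2) / 2 * eta)).

Lemma sinhK (R : realType) : cancel (@sinh R) (@asinh R).
Proof.
move=> x; rewrite /asinh /sinh.
have e0 := expR_gt0 x; have eN0 := expR_gt0 (- x).
have eM : expR x * expR (- x) = 1 by rewrite -expRD subrr expR0.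
have -> : ((expR x - expR (- x)) / 2) ^+ 2 + 1
          = ((expR x + expR (- x)) / 2) ^+ 2 :> R.
  by nra.
rewrite sqrtr_sqr ger0_norm; last by lra.
by rewrite -[RHS]expRK; congr ln; field.
Qed.

Lemma asinhK (R : realType) : cancel (@asinh R) (@sinh R).
Proof.
move=> y; rewrite /asinh /sinh.
set s := Num.sqrt _.
have s2 : s ^+ 2 = y ^+ 2 + 1 by rewrite sqr_sqrtr //; nra.
have s0 : 0 <= s by exact: sqrtr_ge0.
have ys : 0 < y + s by nra.
rewrite expRN lnK ?posrE //.
have -> : (y + s)^-1 = s - y.
  by apply: (mulfI (lt0r_neq0 ys)); rewrite mulfV ?lt0r_neq0 //; nra.
by field.
Qed.

(* The closed formula holds for t >= 0 only. *)
Lemma thetaE (R : realType) (t : R) : 0 <= t ->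
  theta t = Num.sqrt (1 + t ^+ 2 / 2 + t * Num.sqrt (1 + t ^+ 2 / 4)).
Proof.
move=> t0; rewrite /theta /spectral_norm.
set w : R := Num.sqrt (1 + t ^+ 2 / 4).
have w2 : w ^+ 2 = 1 + t ^+ 2 / 4 by rewrite sqr_sqrtr //; nra.
have w0 : 0 <= w by exact: sqrtr_ge0.
have wt : 0 < w + t / 2 by nra.
set m := w + t / 2 in wt.
have mE : m * (w - t / 2) = 1 by rewrite /m; nra.
have m2 : m ^+ 2 = 1 + t * m by rewrite /m; nra.
have ->: 1 + t ^+ 2 / 2 + t * w = m ^+ 2 by rewrite /m; nra.
have NE (x : 'cV[R]_2) : enorm (mx22 1 t 0 1 *m x)
    = Num.sqrt ((x 0 0 + t * x 1 0) ^+ 2 + x 1 0 ^+ 2).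
  rewrite /enorm !big_ord_recl !big_ord0 !mxE !big_ord_recl !big_ord0 !mxE /=.
  have -> : lift ord0 ord0 = 1 :> 'I_2 by exact/val_inj.
  by congr Num.sqrt; ring.
have xE (x : 'cV[R]_2) : enorm x = Num.sqrt (x 0 0 ^+ 2 + x 1 0 ^+ 2).
  rewrite /enorm !big_ord_recl !big_ord0.
  have -> : lift ord0 ord0 = 1 :> 'I_2 by exact/val_inj.
  by congr Num.sqrt; rewrite addr0.
have ub : ubound [set enorm (mx22 1 t 0 1 *m x) |
    x in [set x : 'cV[R]_2 | enorm x <= 1]] (Num.sqrt (m ^+ 2)).
  move=> _ [x /= + <-]; rewrite xE NE => x1; apply: ler_wsqrtr.
  move: (x 0 0) (x 1 0) x1 => u v uv.
  have {}uv : u ^+ 2 + v ^+ 2 <= 1.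
    by rewrite -[leRHS]sqrtr1 ler_sqrt // in uv.
  have : 0 <= m ^+ 2 * (u ^+ 2 + v ^+ 2) - ((u + t * v) ^+ 2 + v ^+ 2).
    have -> : m ^+ 2 * (u ^+ 2 + v ^+ 2) - ((u + t * v) ^+ 2 + v ^+ 2)
              = t * ((w - t / 2) * (m * u - v) ^+ 2).
      have -> : (w - t / 2) * (m * u - v) ^+ 2
        = (m * (w - t / 2)) * (m * u ^+ 2 - 2 * u * v) + (w - t / 2) * v ^+ 2
        by ring.
      by rewrite mE m2 /m; field.
    apply: (mulr_ge0 t0); apply: mulr_ge0; last exact: sqr_ge0.
    nra.
  nra.
apply/eqP; rewrite eq_le; apply/andP; split.
  apply: ge_sup => //; exists (enorm (mx22 1 t 0 1 *m 0)); exists 0 => //=.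
  by rewrite xE !mxE expr0n /= addr0 sqrtr0.
apply: ub_le_sup; first by exists (Num.sqrt (m ^+ 2)).
set r := Num.sqrt (1 + m ^+ 2).
have r2 : r ^+ 2 = 1 + m ^+ 2 by rewrite sqr_sqrtr //; nra.
have r0 : r != 0 by apply/eqP => r0; move: r2; rewrite r0; nra.
exists (\col_i if i == 0 then r^-1 else m / r) => /=.
  rewrite xE !mxE /= -[leRHS]sqrtr1; apply: ler_wsqrtr.
  have -> : r^-1 ^+ 2 + (m / r) ^+ 2 = (1 + m ^+ 2) / r ^+ 2 by field.
  by rewrite r2 divff // -r2 expf_neq0.
rewrite NE !mxE /=; congr Num.sqrt.
have -> : (r^-1 + t * (m / r)) ^+ 2 + (m / r) ^+ 2
          = ((1 + t * m) ^+ 2 + m ^+ 2) / r ^+ 2 by field.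
rewrite -m2 r2.
have h : 1 + m ^+ 2 != 0 by rewrite -r2 expf_neq0.
by field.
Qed.

(* Main.v *)
Require Import Defs.
From mathcomp Require Import all_boot all_order all_algebra.
From mathcomp Require Import all_classical all_reals all_analysis.
From mathcomp Require Import ring lra zify.
Import Order.TTheory GRing.Theory Num.Theory.
Import numFieldNormedType.Exports.
Local Open Scope classical_set_scope.
Local Open Scope ring_scope.

Set Implicit Arguments.
Unset Strict Implicit.

(** Over one cycle, spent for a time t in the first mode and s in the second,
    the state is multiplied by a product of two matrix exponentials.  In the
    coordinates y = Q^-1 x, where Q puts A1 in Jordan form, the first one is
    e^(-n t) times a unipotent shear of norm e^(asinh (t / 2)), and the second
    one is e^((p + q) s / 2) times a conjugate of diag (e^-u, e^u) with
    u = (q - p) s / 2.  Both shapes have determinant 1, and the spectral norm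
    of a matrix of determinant 1 is determined by its Frobenius norm
    ([det1_norm]).  For the second one the norm depends on Q.

    The matrix Q is only determined up to matrices commuting with the Jordan
    block, so a shear may still be inserted.  Choosing it so as to minimise the
    norm of the conjugate of diag (e^-u, e^u) gives exactly
    e^(asinh (sqrt K * sinh u)) with the constant K of the theorem
    ([optimal_shear]).  Hence one cycle multiplies |y| by at most
    exp (growth s - decay t), where decay t = n t - asinh (t / 2) and
    growth s = (p + q) s / 2 + asinh (sqrt K * sinh u), and tau is the positive
    solution of decay tau = growth eta.

    Two inequalities on hyperbolic functions finish the argument.  Since asinh
    is concave on the positive half-line, decay t / t is nondecreasing
    ([decay_ray]); this makes tau unique and gives decay t >= decay tau for
    t >= tau.  Since K >= 1, growth increases with slope at least q > 0
    ([growth_gap]).  Therefore the gain decay t_k - growth s_k of each cycle is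
    nonnegative, and even bounded below by a positive linear form in
    t_k - tau and eta - s_k ([gain_ge]).  Nonnegative gains give stability;
    if the total gain is infinite the solution tends to 0, and if it is finite
    the gains tend to 0, which forces (t_k, s_k) to tend to (tau, eta)
    ([gain_diverges]). *)

(** * Hyperbolic functions *)

Definition cosh (R : realType) (x : R) : R := (expR x + expR (- x)) / 2.
Arguments cosh {R} x.

Section Hyperbolic.
Context {R : realType}.
Implicit Types h k l x y : R.

Lemma cosh2_sinh2 x : cosh x ^+ 2 = 1 + sinh x ^+ 2.
Proof.
have := expRxMexpNx_1 x; rewrite /cosh /sinh.
by move: (expR x) (expR (- x)) => E F EF; nra.
Qed.

Lemma cosh_gt0 x : 0 < cosh x.
Proof. by rewrite /cosh; have := expR_gt0 x; have := expR_gt0 (- x); lra. Qed.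

Lemma sinhD x y : sinh (x + y) = sinh x * cosh y + cosh x * sinh y.
Proof. by rewrite /sinh /cosh opprD !expRD; field. Qed.

Lemma sinh0 : sinh 0 = 0 :> R.
Proof. by rewrite /sinh oppr0 subrr mul0r. Qed.

Lemma ler_sinh : {mono (@sinh R) : x y / x <= y}.
Proof.
apply: le_mono => x y xy; rewrite /sinh.
have : expR x < expR y by rewrite ltr_expR.
have : expR (- y) < expR (- x) by rewrite ltr_expR ltrN2.
by lra.
Qed.

Lemma sinh_ge0 x : 0 <= x -> 0 <= sinh x.
Proof. by move=> x0; rewrite -sinh0 ler_sinh. Qed.

Lemma ler_asinh : {mono (@asinh R) : x y / x <= y}.
Proof. by move=> x y; rewrite -ler_sinh !asinhK. Qed.

Lemma asinh0 : asinh 0 = 0 :> R.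
Proof. by rewrite -[in LHS]sinh0 sinhK. Qed.

Lemma asinh_ge0 x : 0 <= x -> 0 <= asinh x.
Proof. by move=> x0; rewrite -asinh0 ler_asinh. Qed.

Lemma cosh_asinh x : cosh (asinh x) = Num.sqrt (1 + x ^+ 2).
Proof.
have := cosh2_sinh2 (asinh x); rewrite asinhK => <-.
by rewrite sqrtr_sqr ger0_norm // ltW // cosh_gt0.
Qed.

Lemma derive_sinh x : is_derive x 1 (@sinh R) (cosh x).
Proof.
rewrite /sinh; apply: is_derive_eq.
by rewrite /cosh /GRing.scale /=; field.
Qed.

Lemma continuous_asinh : continuous (@asinh R).
Proof.
move=> x; rewrite /asinh; apply: continuous_comp.
  apply: cvgD; first exact: cvg_id.
  apply: continuous_comp; last exact: sqrt_continuous.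
  apply: cvgD; last exact: cvg_cst.
  exact: exprn_continuous.
apply: continuous_ln.
have h : `|x| < Num.sqrt (x ^+ 2 + 1).
  rewrite -sqrtr_sqr ltr_sqrt; nra.
by have := ler_norm (- x); rewrite normrN; lra.
Qed.

Lemma ler_cosh x y : 0 <= x <= y -> cosh x <= cosh y.
Proof.
case/andP=> x0 xy.
rewrite -(@ler_pXn2r _ 2) ?nnegrE ?(ltW (cosh_gt0 _)) // !cosh2_sinh2.
rewrite lerD2l ler_pXn2r // ?nnegrE ?sinh_ge0 ?ler_sinh //.
exact: le_trans xy.
Qed.

(** Convexity of sinh on the positive half-line; the derivative of
    l * sinh x - sinh (l * x) is l * (cosh x - cosh (l * x)). *)
Lemma sinh_scale l x : 0 <= l <= 1 -> 0 <= x -> sinh (l * x) <= l * sinh x.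
Proof.
case/andP=> l0 l1 x0; rewrite -subr_ge0.
pose f (z : R) : R := l * sinh z - sinh (l * z).
have df (z : R) : is_derive z (1 : R) f (l * (cosh z - cosh (l * z))).
  have dz := derive_sinh z; have dlz := derive_sinh (l * z).
  have dl : is_derive z (1 : R) ( *%R l) l.
    by apply: is_derive_eq; rewrite /GRing.scale /= mulr1.
  have dc := @is_derive1_comp _ (@sinh R) ( *%R l) z _ _ dlz dl.
  rewrite (_ : f = l *: (@sinh R) - ((@sinh R) \o ( *%R l))) //.
  by apply: is_derive_eq; rewrite /GRing.scale /=; ring.
have -> : l * sinh x - sinh (l * x) = f x by [].
have -> : 0 = f 0 by rewrite /f mulr0 sinh0 mulr0 subr0.
apply: (@ger0_derive1_ndecr _ f 0 x) => //.
- move=> z /[!in_itv]/= /andP[z0 _]; rewrite derive1E derive_val.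
  apply: mulr_ge0 => //; rewrite subr_ge0; apply: ler_cosh; nra.
- by apply: derivable_within_continuous => z _; have [] := df z.
Qed.

(** The inverse of a convex increasing function is concave; applied to the
    segment from 0 to x. *)
Lemma asinh_scale l x : 0 <= l <= 1 -> 0 <= x -> l * asinh x <= asinh (l * x).
Proof.
by move=> l01 x0; rewrite -ler_sinh asinhK -{2}[x]asinhK sinh_scale ?asinh_ge0.
Qed.

(** Writing v = asinh (k * sinh x), the addition formula reduces the claim to
    cosh v <= k * cosh x, that is, to 1 <= k. *)
Lemma asinh_mul_sinhD k x h : 1 <= k -> 0 <= h ->
  asinh (k * sinh x) + h <= asinh (k * sinh (x + h)).
Proof.
move=> k1 h0; rewrite -ler_sinh asinhK !sinhD asinhK.
rewrite mulrDr mulrA lerD2l mulrA ler_wpM2r ?sinh_ge0 //.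
have c0 := cosh_gt0 x.
rewrite cosh_asinh -[leRHS]ger0_norm; last by nra.
rewrite -sqrtr_sqr ler_wsqrtr // (exprMn 2 k (sinh x)) (exprMn 2 k (cosh x)).
rewrite cosh2_sinh2 mulrDr mulr1 lerD2r.
by rewrite expr_ge1 //; lra.
Qed.

(** By concavity of ln, the graph of asinh lies below a line of any given
    positive slope. *)
Lemma asinh_le_linear k : 0 < k ->
  exists B, forall x, 0 <= x -> asinh x <= k * x + B.
Proof.
move=> k0; exists (k / 2 + ln (2 / k)) => x x0.
have s1 : Num.sqrt (x ^+ 2 + 1) <= x + 1.
  rewrite -[leRHS]ger0_norm; last by lra.
  by rewrite -sqrtr_sqr ler_wsqrtr //; nra.
have s0 : 1 <= Num.sqrt (x ^+ 2 + 1).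
  by rewrite -[leLHS]sqrtr1 ler_wsqrtr //; nra.
rewrite /asinh; set y := x + _.
have y0 : 0 < y * (k / 2) by rewrite /y; nra.
have -> : y = (1 + (y * (k / 2) - 1)) * (2 / k) by field; lra.
rewrite lnM ?posrE ?divr_gt0 //; last by lra.
have : ln (1 + (y * (k / 2) - 1)) <= y * (k / 2) - 1 by apply: le_ln1Dx; lra.
by rewrite /y; nra.
Qed.

Lemma theta_asinh x : 0 <= x -> theta x = expR (asinh (x / 2)).
Proof.
move=> x0; rewrite thetaE // /asinh.
set w := Num.sqrt (1 + x ^+ 2 / 4).
have w2 : w ^+ 2 = 1 + x ^+ 2 / 4 by rewrite sqr_sqrtr //; nra.
have w0 : 0 <= w by exact: sqrtr_ge0.
have -> : (x / 2) ^+ 2 + 1 = 1 + x ^+ 2 / 4 by field.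
rewrite -/w lnK ?posrE; last by nra.
have -> : 1 + x ^+ 2 / 2 + x * w = (x / 2 + w) ^+ 2 by nra.
by rewrite sqrtr_sqr ger0_norm //; nra.
Qed.

End Hyperbolic.

(** * Planar matrices and their norms *)

Section Norms.
Context {R : realType}.

Lemma lift01 : lift ord0 ord0 = 1 :> 'I_2.
Proof. exact/val_inj. Qed.

Lemma ord2_cases (i : 'I_2) : i = 0 \/ i = 1.
Proof. by case: i => [[|[|//]] h]; [left|right]; exact/val_inj. Qed.

Lemma mx22E (a b c d : R) : ((mx22 a b c d 0 0 = a) * (mx22 a b c d 0 1 = b) *
  (mx22 a b c d 1 0 = c) * (mx22 a b c d 1 1 = d))%type.
Proof. by rewrite !mxE. Qed.

Lemma mulmx22E (A B : 'M[R]_2) i j :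
  (A *m B) i j = A i 0 * B 0 j + A i 1 * B 1 j.
Proof. by rewrite mxE !big_ord_recl big_ord0 addr0 lift01. Qed.

Lemma mulmx2E (A : 'M[R]_2) (x : 'cV[R]_2) i :
  (A *m x) i 0 = A i 0 * x 0 0 + A i 1 * x 1 0.
Proof. by rewrite mxE !big_ord_recl big_ord0 addr0 lift01. Qed.

Lemma det_mx22E (A : 'M[R]_2) : \det A = A 0 0 * A 1 1 - A 0 1 * A 1 0.
Proof.
rewrite (expand_det_row _ 0) !big_ord_recl big_ord0 addr0 lift01.
rewrite /cofactor !det_mx11 !mxE /= expr0 expr1.
have -> : lift 0 0 = 1 :> 'I_2 by exact/val_inj.
have -> : lift 1 0 = 0 :> 'I_2 by exact/val_inj.
by ring.
Qed.

Lemma enormE (x : 'cV[R]_2) : enorm x = Num.sqrt (x 0 0 ^+ 2 + x 1 0 ^+ 2).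
Proof. by rewrite /enorm !big_ord_recl big_ord0 addr0 lift01. Qed.

Lemma enorm_ge0 (x : 'cV[R]_2) : 0 <= enorm x.
Proof. exact: sqrtr_ge0. Qed.

Lemma ler_enorm k (x y : 'cV[R]_2) : 0 <= k ->
  x 0 0 ^+ 2 + x 1 0 ^+ 2 <= k ^+ 2 * (y 0 0 ^+ 2 + y 1 0 ^+ 2) ->
  enorm x <= k * enorm y.
Proof.
move=> k0 xy; rewrite !enormE -[k]ger0_norm // -sqrtr_sqr -sqrtrM ?sqr_ge0 //.
exact: ler_wsqrtr.
Qed.

Lemma enormZ k (x : 'cV[R]_2) : 0 <= k -> enorm (k *: x) = k * enorm x.
Proof.
move=> k0; rewrite !enormE !mxE !exprMn -mulrDr sqrtrM ?sqr_ge0 //.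
by rewrite sqrtr_sqr ger0_norm.
Qed.

Lemma enorm_mulmx_bounded (A : 'M[R]_2) :
  exists2 C, 0 < C & forall x : 'cV[R]_2, enorm (A *m x) <= C * enorm x.
Proof.
pose F := A 0 0 ^+ 2 + A 0 1 ^+ 2 + A 1 0 ^+ 2 + A 1 1 ^+ 2.
have F0 : 0 <= F by rewrite /F !addr_ge0 ?sqr_ge0.
exists (1 + F); first by lra.
move=> x; apply: ler_enorm; first by lra.
rewrite !mulmx2E /F; move: (x 0 0) (x 1 0) F F0 => u v F F0.
move: (A 0 0) (A 0 1) (A 1 0) (A 1 1) => a b c d.
have CS (p q : R) :
    (p * u + q * v) ^+ 2 <= (p ^+ 2 + q ^+ 2) * (u ^+ 2 + v ^+ 2).
  by have := sqr_ge0 (p * v - q * u); nra.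
have uv : 0 <= u ^+ 2 + v ^+ 2 by rewrite addr_ge0 ?sqr_ge0.
apply: le_trans (lerD (CS a b) (CS c d)) _; rewrite -mulrDl ler_wpM2r //.
have : 0 <= a ^+ 2 + b ^+ 2 + c ^+ 2 + d ^+ 2 by rewrite !addr_ge0 ?sqr_ge0.
by nra.
Qed.

(** A matrix [B] of determinant 1 has singular values s and 1 / s, and its
    squared Frobenius norm is s^2 + s^-2 = 2 + (s - 1 / s)^2; with
    s = exp z this is 2 + 4 sinh(z)^2.  The bound holds because
    s^2 I - B^T B has a nonnegative trace and determinant zero. *)
Lemma det1_norm (B : 'M[R]_2) y : 0 <= y ->
  B 0 0 * B 1 1 - B 0 1 * B 1 0 = 1 ->
  B 0 0 ^+ 2 + B 0 1 ^+ 2 + B 1 0 ^+ 2 + B 1 1 ^+ 2 = 2 + 4 * y ^+ 2 ->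
  forall x, enorm (B *m x) <= expR (asinh y) * enorm x.
Proof.
move=> y0 detB frobB x; apply: ler_enorm; first exact: expR_ge0.
rewrite !mulmx2E; have z0 := asinh_ge0 y0.
have := expRxMexpNx_1 (asinh y); have := asinhK y; rewrite /sinh.
set s := expR (asinh y); set s' := expR (- _) => yE ss'.
have s1 : 1 <= s by rewrite -expR0 ler_expR.
have s'1 : s' <= 1 by rewrite -expR0 ler_expR oppr_le0.
have s'0 : 0 <= s' by exact: expR_ge0.
have trE : B 0 0 ^+ 2 + B 0 1 ^+ 2 + B 1 0 ^+ 2 + B 1 1 ^+ 2
    = s ^+ 2 + s' ^+ 2 by rewrite frobB -yE; nra.
move: (x 0 0) (x 1 0) (B 0 0) (B 0 1) (B 1 0) (B 1 1) detB trE {frobB yE}.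
move=> u v a b c d detB trE.
pose al := s ^+ 2 - (a ^+ 2 + c ^+ 2).
pose be := s ^+ 2 - (b ^+ 2 + d ^+ 2).
pose ga := a * b + c * d.
have albe : al * be = ga ^+ 2.
  have s4 : s ^+ 2 * (s ^+ 2 + s' ^+ 2) = s ^+ 4 + (s * s') ^+ 2 by ring.
  have : (a ^+ 2 + c ^+ 2) * (b ^+ 2 + d ^+ 2) = ga ^+ 2 + (a * d - b * c) ^+ 2.
    by rewrite /ga; ring.
  have -> : al * be = s ^+ 4 - s ^+ 2 * (a ^+ 2 + b ^+ 2 + c ^+ 2 + d ^+ 2)
    + (a ^+ 2 + c ^+ 2) * (b ^+ 2 + d ^+ 2) by rewrite /al /be; ring.
  by rewrite trE s4 ss' detB => ->; ring.
have albe0 : 0 <= al + be.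
  have -> : al + be = s ^+ 2 - s' ^+ 2 by move: trE; rewrite /al /be; lra.
  by nra.
have ga0 := sqr_ge0 ga.
have al0 : 0 <= al by nra.
have be0 : 0 <= be by nra.
rewrite -subr_ge0.
have -> : s ^+ 2 * (u ^+ 2 + v ^+ 2)
    - ((a * u + b * v) ^+ 2 + (c * u + d * v) ^+ 2)
  = al * u ^+ 2 - 2 * ga * (u * v) + be * v ^+ 2 by rewrite /al /be /ga; ring.
(* (al + be) times the form is a sum of two squares. *)
have [ab0|ab0] := eqVneq (al + be) 0.
  have a0 : al = 0 by lra.
  have b0 : be = 0 by lra.
  have g0 : ga = 0 by apply/eqP; rewrite -sqrf_eq0 -albe a0 mul0r.
  by rewrite a0 b0 g0; lra.
have abp : 0 < al + be by rewrite lt0r ab0.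
rewrite -(pmulr_rge0 _ abp).
have -> : (al + be) * (al * u ^+ 2 - 2 * ga * (u * v) + be * v ^+ 2)
  = (al * u - ga * v) ^+ 2 + (be * v - ga * u) ^+ 2
    + (al * be - ga ^+ 2) * (u ^+ 2 + v ^+ 2) by ring.
by rewrite albe subrr mul0r addr0 addr_ge0 ?sqr_ge0.
Qed.

End Norms.

(** * Choice of the shear *)

Section Shear.
Context {R : realType}.

(** The identity (ad + bc)^2 = 1 + 4 (ac) (bd) shows what a shear can do: it
    makes [bd] arbitrary when [ac = 0], and any value with 4 (ac) (bd) >= -1
    otherwise.  So [ac + bd] can be made 0 when 2 |ac| <= 1, and its modulus
    can be brought down to |ac - 1 / (4 ac)|, but no further, when
    2 |ac| > 1. *)
Lemma optimal_shear (a b c d : R) : (a * d - b * c) ^+ 2 = 1 ->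
  let r := Num.max (2 * `|a * c|) 1 in
  exists be, 1 + (a * c + (b + be * a) * (d + be * c)) ^+ 2
    = 1 / 4 * (r^-1 + r) ^+ 2.
Proof.
move=> det1 r; have [r1|r1] := leP (2 * `|a * c|) 1.
  have rE : r = 1 by rewrite /r max_r.
  suff [be beE] : exists be, a * c + (b + be * a) * (d + be * c) = 0.
    by exists be; rewrite beE rE invr1; field.
  have [ac0|ac0] := eqVneq (a * c) 0.
    have sE : (a * d + b * c) ^+ 2 = 1.
      have -> : (a * d + b * c) ^+ 2
          = (a * d - b * c) ^+ 2 + 4 * (a * c) * (b * d) by ring.
      by rewrite det1 ac0; ring.
    have s0 : a * d + b * c != 0 by rewrite -sqrf_eq0 sE oner_eq0.
    exists (- (b * d) / (a * d + b * c)).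
    have -> : a * c + (b + - (b * d) / (a * d + b * c) * a)
        * (d + - (b * d) / (a * d + b * c) * c)
      = (a * c) * (1 + (b * d) ^+ 2 / (a * d + b * c) ^+ 2) by field.
    by rewrite ac0 mul0r.
  have ac20 : 0 <= 1 - 4 * (a * c) ^+ 2.
    by have := real_normK (num_real (a * c)); have := normr_ge0 (a * c); nra.
  exists ((Num.sqrt (1 - 4 * (a * c) ^+ 2) - (a * d + b * c)) / (2 * (a * c))).
  have := sqr_sqrtr ac20; set w := Num.sqrt _ => w2.
  have /andP[a0 c0] : (a != 0) && (c != 0) by rewrite -negb_or -mulf_eq0.
  have -> : a * c + (b + (w - (a * d + b * c)) / (2 * (a * c)) * a)
      * (d + (w - (a * d + b * c)) / (2 * (a * c)) * c)
    = (4 * (a * c) ^+ 2 + w ^+ 2 - (a * d - b * c) ^+ 2) / (4 * (a * c)).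
    by field; rewrite a0 c0.
  by rewrite w2 det1 [_ + (1 - _)]addrC subrK subrr mul0r.
have rE : r = 2 * `|a * c| by rewrite /r max_l // ltW.
have ac0 : a * c != 0 by rewrite -normr_gt0; lra.
have /andP[a0 c0] : (a != 0) && (c != 0) by rewrite -negb_or -mulf_eq0.
exists (- (a * d + b * c) / (2 * (a * c))).
have -> : a * c + (b + - (a * d + b * c) / (2 * (a * c)) * a)
      * (d + - (a * d + b * c) / (2 * (a * c)) * c)
    = a * c - (a * d - b * c) ^+ 2 / (4 * (a * c)) by field; rewrite a0 c0.
have n2 := real_normK (num_real (a * c)).
have n0 : `|a * c| != 0 by rewrite normr_eq0.
rewrite det1 rE.
have -> : 1 / 4 * ((2 * `|a * c|)^-1 + 2 * `|a * c|) ^+ 2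
  = (`|a * c| ^+ 2)^-1 / 16 + 1 / 2 + `|a * c| ^+ 2 by field.
by rewrite n2; field; rewrite a0 c0.
Qed.

End Shear.

(** * Decay and growth exponents *)

Definition decay (R : realType) (n t : R) : R := n * t - asinh (t / 2).
Definition growth (R : realType) (p q K s : R) : R :=
  (p + q) / 2 * s + asinh (Num.sqrt K * sinh ((q - p) / 2 * s)).
Arguments decay {R} n t.
Arguments growth {R} p q K s.

Section Exponents.
Context {R : realType}.
Implicit Types n p q K s t : R.

Lemma decayE n t : 0 <= t -> n * t - ln (theta t) = decay n t.
Proof. by move=> t0; rewrite theta_asinh // expRK. Qed.

Lemma decay_scale n l t : 0 <= l <= 1 -> 0 <= t ->
  decay n (l * t) <= l * decay n t.
Proof.
move=> l01 t0; have t20 : 0 <= t / 2 by lra.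
have := asinh_scale l01 t20; rewrite /decay mulrA; nra.
Qed.

Lemma decay_ray n s t : 0 < s <= t -> t / s * decay n s <= decay n t.
Proof.
case/andP=> s0 st; have t0 : 0 < t by exact: lt_le_trans st.
have l01 : 0 <= s / t <= 1.
  by rewrite divr_ge0 ?(ltW s0) ?(ltW t0) //= ler_pdivrMr // mul1r.
have := decay_scale n l01 (ltW t0); rewrite divfK ?gt_eqF // => H.
rewrite -[leRHS](mulKf (_ : s / t != 0)); last by rewrite gt_eqF ?divr_gt0.
by rewrite invf_div ler_wpM2l // divr_ge0 ?ltW.
Qed.

Lemma decay_ge_linear n : 0 < n ->
  exists2 B, 0 <= B & forall t, 0 <= t -> n / 2 * t - B <= decay n t.
Proof.
move=> n0; have [B HB] := asinh_le_linear n0.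
exists B; first by have := HB 0 (lexx _); rewrite asinh0 mulr0 add0r.
move=> t t0; have t20 : 0 <= t / 2 by lra.
by have := HB _ t20; rewrite /decay; lra.
Qed.

Lemma continuous_decay n : continuous (decay n).
Proof.
move=> t; rewrite /decay; apply: cvgB.
  by apply: cvgM; [exact: cvg_cst|exact: cvg_id].
apply: continuous_comp; last exact: continuous_asinh.
by apply: cvgM; [exact: cvg_id|exact: cvg_cst].
Qed.

(** Existence comes from the intermediate value theorem, uniqueness from the
    fact that decay grows at least linearly along rays. *)
Lemma decay_unique_level n G : 0 < n -> 0 < G ->
  exists! t, 0 < t /\ decay n t = G.
Proof.
move=> n0 G0; have [B B0 HB] := decay_ge_linear n0.
have d0 : decay n 0 = 0 by rewrite /decay mulr0 mul0r asinh0 subr0.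
pose T := 2 * (B + G) / n.
have T0 : 0 <= T by rewrite /T divr_ge0 ?(ltW n0) //; lra.
have HT : G <= decay n T.
  apply: le_trans (HB _ T0).
  have -> : n / 2 * T = B + G by rewrite /T; field; lra.
  by lra.
have [||t /[!in_itv]/= /andP[t0 _] tG] := @IVT _ (decay n) 0 T G T0.
- by apply: continuous_subspaceT; exact: continuous_decay.
- by rewrite d0 ge_min le_max HT (ltW G0) orbT.
have uniq s1 s2 : 0 < s1 -> s1 < s2 -> decay n s1 = G -> decay n s2 <> G.
  move=> s10 s12 E1 E2.
  have := @decay_ray n s1 s2; rewrite s10 (ltW s12) => /(_ isT).
  rewrite E1 E2 -[leRHS]mul1r ler_pM2r // ler_pdivrMr // mul1r; lra.
have tp : 0 < t.
  by rewrite lt_neqAle t0 andbT; apply/eqP => t_0; rewrite -t_0 d0 in tG; lra.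
exists t; split=> // s [s0 sG]; case: (ltgtP t s) => // [ts|st].
  by case: (uniq _ _ tp ts tG).
by case: (uniq _ _ s0 st sG).
Qed.

Lemma growth0 p q K : growth p q K 0 = 0.
Proof. by rewrite /growth !mulr0 sinh0 mulr0 asinh0 addr0. Qed.

Lemma growthD p q K s h : 1 <= K -> p <= q -> 0 <= h ->
  growth p q K s + q * h <= growth p q K (s + h).
Proof.
move=> K1 pq h0; rewrite /growth.
have k1 : 1 <= Num.sqrt K by rewrite -[leLHS]sqrtr1 ler_wsqrtr.
have h'0 : 0 <= (q - p) / 2 * h by rewrite mulr_ge0 //; lra.
have := asinh_mul_sinhD ((q - p) / 2 * s) k1 h'0.
by rewrite -mulrDr; lra.
Qed.

Lemma growth_gap p q K s t : 1 <= K -> p <= q -> s <= t ->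
  q * (t - s) <= growth p q K t - growth p q K s.
Proof.
move=> K1 pq st; have h0 : 0 <= t - s by rewrite subr_ge0.
by have := growthD s K1 pq h0; rewrite subrKC; lra.
Qed.

(** The scalar parts e^(-n t) and e^((p + q) s / 2) split off, and what is
    left has determinant 1. *)
Lemma enorm_jordan_flow n t (y : 'cV[R]_2) : 0 <= t ->
  enorm (expR (- n * t) *: (mx22 1 t 0 1 *m y)) <= expR (- decay n t) * enorm y.
Proof.
move=> t0; rewrite enormZ ?expR_ge0 //.
have -> : - decay n t = - n * t + asinh (t / 2) by rewrite /decay; lra.
rewrite expRD -[leRHS]mulrA ler_pM2l ?expR_gt0 //.
apply: det1_norm; rewrite ?mxE /=; first lra.
  by ring.
by field.
Qed.

(** With u = (q - p) s / 2, the determinant 1 part of the conjugated flow has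
    squared Frobenius norm 2 + 4 (1 + (ac + bd)^2) sinh(u)^2, where a, b, c, d
    are the entries of [N]. *)
Lemma enorm_diagonal_flow p q K s (N : 'M[R]_2) : p <= q -> 0 <= s ->
  (\det N) ^+ 2 = 1 ->
  1 + (N 0 0 * N 1 0 + N 0 1 * N 1 1) ^+ 2 = K ->
  forall y : 'cV[R]_2,
  enorm (invmx N *m (mx22 (expR (p * s)) 0 0 (expR (q * s)) *m (N *m y)))
    <= expR (growth p q K s) * enorm y.
Proof.
move=> pq s0 detN KE y.
have detE : \det N = N 0 0 * N 1 1 - N 0 1 * N 1 0 by exact: det_mx22E.
pose e := \det N.
have e2 : e * e = 1 by rewrite -expr2.
have eV : e^-1 = e.
  have e0 : e != 0 by rewrite -sqrf_eq0 detN oner_eq0.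
  by apply: (mulfI e0); rewrite divff.
have uN : N \in unitmx by rewrite unitmxE unitfE -sqrf_eq0 detN oner_eq0.
have invE : invmx N = e *: mx22 (N 1 1) (- N 0 1) (- N 1 0) (N 0 0).
  apply: (can_inj (mulKmx uN)); rewrite mulmxV // -scalemxAr.
  have eE : e * (N 0 0 * N 1 1 - N 0 1 * N 1 0) = 1 by rewrite -detE.
  apply/matrixP => i j; rewrite mxE [RHS]mxE mulmx22E.
  have [->|->] := ord2_cases i; have [->|->] := ord2_cases j.
  - by rewrite !mxE /= -eE; ring.
  - by rewrite !mxE /=; ring.
  - by rewrite !mxE /=; ring.
  - by rewrite !mxE /= -eE; ring.
pose u := (q - p) / 2 * s.
pose E := expR (- u); pose F := expR u.
have -> : mx22 (expR (p * s)) 0 0 (expR (q * s))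
    = expR ((p + q) / 2 * s) *: mx22 E 0 0 F.
  have [pE qE] : p * s = (p + q) / 2 * s + - u /\ q * s = (p + q) / 2 * s + u.
    by rewrite /u; split; field.
  rewrite pE qE !expRD; apply/matrixP => i j; rewrite !mxE.
  have [->|->] := ord2_cases i; have [->|->] := ord2_cases j;
    by rewrite /= ?mulr0.
rewrite -!scalemxAl -scalemxAr enormZ ?expR_ge0 //.
rewrite /growth expRD -[leRHS]mulrA ler_pM2l ?expR_gt0 // -/u !mulmxA.
have EF : E * F = 1 by rewrite /E /F mulrC expRxMexpNx_1.
have u0 : 0 <= u by rewrite mulr_ge0 //; lra.
have K0 : 0 <= K by rewrite -KE addr_ge0 ?sqr_ge0.
apply: det1_norm; first by rewrite mulr_ge0 ?sqrtr_ge0 ?sinh_ge0.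
  rewrite invE !mulmx22E !mxE /=.
  transitivity ((E * F) * (e * e) * (N 0 0 * N 1 1 - N 0 1 * N 1 0) ^+ 2).
    by ring.
  by rewrite EF e2 -detE detN !mulr1.
rewrite (exprMn 2 (Num.sqrt K)) sqr_sqrtr // -KE invE !mulmx22E !mxE /= /sinh.
rewrite -/E -/F.
transitivity ((e * e) * (2 * (N 0 0 * N 1 1 - N 0 1 * N 1 0) ^+ 2 * (E * F)
  + ((N 0 0 * N 1 1 - N 0 1 * N 1 0) ^+ 2
     + (N 0 0 * N 1 0 + N 0 1 * N 1 1) ^+ 2) * (F - E) ^+ 2)).
  by ring.
by rewrite e2 -detE detN EF; field.
Qed.

End Exponents.

(** * Solutions of planar linear equations *)

Section Flows.
Context {R : realType}.

(** Uniqueness for a resonantly forced scalar equation: the function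
    e^(-lam (t - a)) phi t - mu (t - a) has derivative zero. *)
Lemma forced_exponential (phi : R -> R) (a b lam mu : R) : a <= b ->
  {within `[a, b], continuous phi} ->
  (forall t, a < t < b ->
    is_derive t 1 phi (lam * phi t + mu * expR (lam * (t - a)))) ->
  phi b = expR (lam * (b - a)) * (phi a + mu * (b - a)).
Proof.
move=> ab cphi dphi.
pose g (t : R) : R := expR (- lam * (t - a)).
have dg (t : R) : is_derive t (1 : R) g (- lam * g t).
  have dl : is_derive t (1 : R) (fun t => - lam * (t - a)) (- lam).
    by apply: is_derive_eq; rewrite /GRing.scale /=; ring.
  rewrite mulrC.
  exact: (@is_derive1_comp _ (@expR R) _ t _ _ (is_derive_expR _) dl).
pose psi (t : R) : R := g t * phi t - mu * (t - a).
have dpsi t : t \in `]a, b[ -> is_derive t (1 : R) psi 0.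
  rewrite in_itv /= => /dphi dt; have dgt := dg t; rewrite /psi.
  apply: is_derive_eq; rewrite /GRing.scale /= mulrDr.
  rewrite [g t * (mu * _)]mulrCA /g -expRD mulNr addNr expR0; ring.
have cpsi : {within `[a, b], continuous psi}.
  have cg : {within `[a, b], continuous g}.
    by apply: derivable_within_continuous => t _; have [] := dg t.
  move=> t; apply: cvgB; first by apply: cvgM; [exact: cg|exact: cphi].
  apply: (@continuous_subspaceT _ _ _ (fun t : R => mu * (t - a))) => s.
  apply: cvgM; first exact: cvg_cst.
  by apply: cvgB; [exact: cvg_id|exact: cvg_cst].
have [c _] := @MVT_segment _ psi (fun=> 0) a b ab dpsi cpsi.
rewrite mul0r /psi /g !subrr !mulr0 expR0 mul1r subr0.
set E := expR _ => E1.
have EE : expR (lam * (b - a)) * E = 1.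
  by rewrite /E -expRD mulNr subrr expR0.
by rewrite -[LHS]mul1r -EE -mulrA; congr (_ * _); lra.
Qed.

Lemma is_derive_mulmx_coord (W : 'M[R]_2) (x : R -> 'cV[R]_2) (t : R) v i :
  is_derive t (1 : R) x v ->
  is_derive t (1 : R) (fun t => (W *m x t) i 0) ((W *m v) i 0).
Proof.
move=> dx; have [dfx xv] := dx.
have dxj j : is_derive t (1 : R) (fun t => x t j 0) (v j 0).
  split; first by move/derivable_mxP : dfx; exact.
  by rewrite -xv (derive_mx dfx) mxE.
rewrite mulmx2E.
rewrite (_ : (fun t => _) =
    (fun t => W i 0 * x t 0 0) + (fun t => W i 1 * x t 1 0)); last first.
  by apply/funext => s; rewrite mulmx2E.
have d0 := dxj 0; have d1 := dxj 1.
exact: is_derive_eq.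
Qed.

Lemma continuous_mulmx_coord (W : 'M[R]_2) (x : R -> 'cV[R]_2) (D : set R) i :
  {within D, continuous x} -> {within D, continuous (fun t => (W *m x t) i 0)}.
Proof.
move=> cx t.
have cj j : continuous (fun s : subspace D => x s j 0).
  move=> s.
  apply: (@continuous_comp (subspace D) _ _ x (fun M : 'cV[R]_2 => M j 0)).
    exact: cx.
  exact: coord_continuous.
rewrite (_ : (fun t => _) =
    (fun t => W i 0 * x t 0 0) + (fun t => W i 1 * x t 1 0)); last first.
  by apply/funext => s; rewrite mulmx2E.
by apply: cvgD; apply: cvgM; (exact: cvg_cst || exact: cj).
Qed.

Definition trajectory (A : 'M[R]_2) (x : R -> 'cV[R]_2) (a b : R) :=
  {within `[a, b], continuous x} /\
  forall t : R, a < t < b -> is_derive t (1 : R) x (A *m x t).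

Lemma trajectory_prefix A x a b t : t <= b ->
  trajectory A x a b -> trajectory A x a t.
Proof.
move=> tb [cx dx]; split.
  apply: continuous_subspaceW cx => s /=; rewrite !in_itv /=.
  by case/andP=> -> /= st; exact: le_trans tb.
by move=> s /andP[sa st]; apply: dx; rewrite sa (lt_le_trans st).
Qed.

Lemma is_derive_trajectory (A W J : 'M[R]_2) x a b t i : W *m A = J *m W ->
  trajectory A x a b -> a < t < b ->
  is_derive t (1 : R) (fun s => (W *m x s) i 0)
    (J i 0 * (W *m x t) 0 0 + J i 1 * (W *m x t) 1 0).
Proof.
move=> WA [_ dx] /dx dxt; rewrite -mulmx2E mulmxA -WA -mulmxA.
exact: is_derive_mulmx_coord.
Qed.

(** The second coordinate is an exponential; it acts on the first one as a
    resonant forcing. *)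
Lemma jordan_flow (A W : 'M[R]_2) lam x a b : a <= b ->
  W *m A = mx22 lam 1 0 lam *m W -> trajectory A x a b ->
  W *m x b = expR (lam * (b - a)) *: (mx22 1 (b - a) 0 1 *m (W *m x a)).
Proof.
move=> ab WA tr.
have y1 t : a <= t <= b ->
    (W *m x t) 1 0 = expR (lam * (t - a)) * (W *m x a) 1 0.
  case/andP=> le_at tb; have trt := trajectory_prefix tb tr.
  transitivity (expR (lam * (t - a)) * ((W *m x a) 1 0
      + 0 * (t - a))); last first.
    by rewrite mul0r addr0.
  apply: (@forced_exponential (fun s => (W *m x s) 1 0)) => //.
  - by apply: continuous_mulmx_coord; have [] := trt.
  - move=> s ast; have := is_derive_trajectory 1 WA trt ast.
    by rewrite !mxE /= !mul0r add0r addr0.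
have y0 : (W *m x b) 0 0 =
    expR (lam * (b - a)) * ((W *m x a) 0 0 + (W *m x a) 1 0 * (b - a)).
  apply: (@forced_exponential (fun s => (W *m x s) 0 0)) => //.
    by apply: continuous_mulmx_coord; have [] := tr.
  move=> s asb; have := is_derive_trajectory 0 WA tr asb.
  rewrite y1; last by case/andP: asb => sa sb; rewrite !ltW.
  by rewrite !mxE /= mul1r [expR _ * _]mulrC.
apply/matrixP => i j; rewrite (ord1 j) [RHS]mxE [in RHS]mulmx2E.
have [->|->] := ord2_cases i.
  by rewrite y0 !mx22E mul1r [(b - a) * _]mulrC.
by rewrite y1 ?ab ?lexx // !mx22E mul0r add0r mul1r.
Qed.

Lemma diagonal_flow (A W : 'M[R]_2) p q x a b : a <= b ->
  W *m A = mx22 p 0 0 q *m W -> trajectory A x a b ->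
  W *m x b = mx22 (expR (p * (b - a))) 0 0 (expR (q * (b - a))) *m (W *m x a).
Proof.
move=> ab WA tr.
have y0 : (W *m x b) 0 0 = expR (p * (b - a)) * (W *m x a) 0 0.
  transitivity (expR (p * (b - a)) * ((W *m x a) 0 0
      + 0 * (b - a))); last first.
    by rewrite mul0r addr0.
  apply: (@forced_exponential (fun s => (W *m x s) 0 0)) => //.
  - by apply: continuous_mulmx_coord; have [] := tr.
  - move=> s asb; have := is_derive_trajectory 0 WA tr asb.
    by rewrite !mxE /= !mul0r.
have y1 : (W *m x b) 1 0 = expR (q * (b - a)) * (W *m x a) 1 0.
  transitivity (expR (q * (b - a)) * ((W *m x a) 1 0
      + 0 * (b - a))); last first.
    by rewrite mul0r addr0.
  apply: (@forced_exponential (fun s => (W *m x s) 1 0)) => //.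
  - by apply: continuous_mulmx_coord; have [] := tr.
  - move=> s asb; have := is_derive_trajectory 1 WA tr asb.
    by rewrite !mxE /= !mul0r add0r addr0.
apply/matrixP => i j; rewrite (ord1 j) [in RHS]mulmx2E.
have [->|->] := ord2_cases i.
  by rewrite y0 !mx22E mul0r addr0.
by rewrite y1 !mx22E mul0r add0r.
Qed.

End Flows.

(** * Switching signals and cycles *)

Section Switching.
Context {R : realType}.
Implicit Types (n p q K B tau eta : R) (sigma : R -> mode) (d : nat -> R).

Lemma switching_times_ndecr sigma d : switching_times sigma d ->
  {homo d : i j / (i <= j)%N >-> i <= j}.
Proof.
case=> _ d1 _ _ _; apply: homo_leq => //; first exact: le_trans.
by move=> i; exact: ltW.
Qed.

Lemma switching_times_ge0 sigma d k : switching_times sigma d -> 0 <= d k.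
Proof.
by move=> sw; have [d0 _ _ _ _] := sw; rewrite -d0 (switching_times_ndecr sw).
Qed.

Lemma switching_modes sigma d k : switching_times sigma d -> sigma 0 = mode1 ->
  sigma (d (2 * k)%N) = mode1 /\ sigma (d (2 * k + 1)%N) = mode2.
Proof.
case=> d0 _ _ _ alt s0.
have step j : sigma (d j) = mode1 -> sigma (d j.+1) = mode2.
  by move=> sj; have := alt j; rewrite sj; case: (sigma _).
have step' j : sigma (d j) = mode2 -> sigma (d j.+1) = mode1.
  by move=> sj; have := alt j; rewrite sj; case: (sigma _).
elim: k => [|k [_ IH2]].
  have s0' : sigma (d 0%N) = mode1 by rewrite d0.
  by split; [exact: s0'|exact: step].
have s1 : sigma (d (2 * k.+1)%N) = mode1.
  have -> : (2 * k.+1 = (2 * k + 1).+1)%N by lia.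
  exact: step'.
by split=> //; rewrite addn1; exact: step.
Qed.

Lemma cycle_of_time sigma d t : switching_times sigma d -> 0 <= t ->
  exists k, d (2 * k)%N <= t < d (2 * k + 2)%N.
Proof.
move=> sw t0; have [d0 _ dy _ _] := sw; have dm := switching_times_ndecr sw.
have ex : exists m, t < d (2 * m + 2)%N.
  have [m _ Hm] : \forall m \near \oo, t < d m by move/cvgryPgt : dy; exact.
  by exists m; apply: lt_le_trans (Hm m (leqnn m)) _; apply: dm; lia.
exists (ex_minn ex); case: ex_minnP => m tm minm; rewrite tm andbT.
case: m tm minm => [_ _|m _ minm]; first by rewrite d0.
rewrite leNgt; apply/negP => tm; suff : (m.+1 <= m)%N by rewrite ltnn.
by apply: minm; have -> : (2 * m + 2 = 2 * m.+1)%N by lia.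
Qed.

Lemma solution_trajectory (A1 A2 : 'M[R]_2) sigma d x k t :
  switching_times sigma d -> solution A1 A2 sigma x -> d k <= t <= d k.+1 ->
  trajectory (subsystem A1 A2 (sigma (d k))) x (d k) t.
Proof.
move=> sw [cx dx] /andP[dt td]; apply: (trajectory_prefix td).
have dk0 := switching_times_ge0 k sw; have [_ _ _ cst _] := sw.
split.
  apply: continuous_subspaceW cx => s /=; rewrite !in_itv /= andbT.
  by case/andP=> ds _; exact: le_trans ds.
move=> s /andP[ds sd].
have ss : sigma s = sigma (d k) by apply: cst; rewrite ltW.
rewrite -ss; apply: dx; first exact: le_lt_trans ds.
near=> u; rewrite ss; apply: cst.
have : u \in `]d k, d k.+1[.
  by near: u; apply: near_in_itvoo; rewrite in_itv /= ds.
by rewrite in_itv /= => /andP[du ->]; rewrite ltW.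
Unshelve. all: by end_near. Qed.

(** [v] stands for the norm of a solution in well chosen coordinates. *)
Definition cycle_bounded n p q K d (v : R -> R) :=
  forall k t,
  (d (2 * k)%N <= t <= d (2 * k + 1)%N ->
     v t <= expR (- decay n (t - d (2 * k)%N)) * v (d (2 * k)%N)) /\
  (d (2 * k + 1)%N <= t <= d (2 * k + 2)%N ->
     v t <= expR (growth p q K (t - d (2 * k + 1)%N)) * v (d (2 * k + 1)%N)).

Definition gain n p q K d k : R :=
  decay n (dwell1 d k) - growth p q K (dwell2 d k).

(** The decay over t_k is at least (t_k / tau) times the decay over tau, and
    growth increases with slope at least q. *)
Lemma gain_ge n p q K tau eta sigma d k : 0 < q -> 1 <= K -> p <= q ->
  0 < tau -> decay n tau = growth p q K eta ->
  dwell_bounds tau eta sigma d ->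
  growth p q K eta / tau * (dwell1 d k - tau) + q * (eta - dwell2 d k)
    <= gain n p q K d k.
Proof.
move=> q0 K1 pq tau0 tauE [_ _ /(_ k)[ht hs]]; rewrite /gain.
have gs := growth_gap K1 pq hs.
have := @decay_ray _ n tau (dwell1 d k); rewrite tau0 ht => /(_ isT).
rewrite tauE => dt.
have -> : growth p q K eta / tau * (dwell1 d k - tau)
  = dwell1 d k / tau * growth p q K eta - growth p q K eta by field; lra.
lra.
Qed.

Lemma norm_at_cycle n p q K d v k : cycle_bounded n p q K d v ->
  {homo d : i j / (i <= j)%N >-> i <= j} ->
  v (d (2 * k)%N) <= expR (- series (gain n p q K d) k) * v (d 0%N).
Proof.
move=> Hv dm; elim: k => [|k IH].
  by rewrite seriesEnat /= big_geq // oppr0 expR0 mul1r.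
have -> : (2 * k.+1 = 2 * k + 2)%N by lia.
have [_ /(_ _)/le_trans] := Hv k (d (2 * k + 2)%N).
apply; first by rewrite lexx andbT; apply: dm; lia.
have [/(_ _) H _] := Hv k (d (2 * k + 1)%N).
have -> : expR (- series (gain n p q K d) k.+1) =
    expR (growth p q K (dwell2 d k)) *
    (expR (- decay n (dwell1 d k)) * expR (- series (gain n p q K d) k)).
  by rewrite -!expRD seriesSr /gain; congr expR; lra.
rewrite -/(dwell2 d k).
apply: (@le_trans _ _ (expR (growth p q K (dwell2 d k)) *
  (expR (- decay n (dwell1 d k)) * v (d (2 * k)%N)))).
  by rewrite ler_pM2l ?expR_gt0 // H // lexx andbT; apply: dm; lia.
by rewrite -!mulrA !ler_pM2l ?expR_gt0.
Qed.

Lemma norm_within_cycle n p q K B eta d v k t : 0 < q -> 1 <= K -> p <= q ->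
  (forall s, 0 <= s -> - B <= decay n s) -> 0 <= growth p q K eta ->
  {homo d : i j / (i <= j)%N >-> i <= j} ->
  dwell2 d k <= eta ->
  cycle_bounded n p q K d v -> (forall s, 0 <= v s) ->
  d (2 * k)%N <= t <= d (2 * k + 2)%N ->
  v t <= expR (B + growth p q K eta) * v (d (2 * k)%N).
Proof.
move=> q0 K1 pq HB G0 dm hs Hv v0 /andP[dt td].
have in1 s : d (2 * k)%N <= s <= d (2 * k + 1)%N ->
    v s <= expR B * v (d (2 * k)%N).
  move=> hs'; have [H _] := Hv k s; apply: le_trans (H hs') _.
  rewrite ler_wpM2r // ler_expR; have := HB (s - d (2 * k)%N).
  by case/andP: hs' => hs' _; rewrite subr_ge0 hs' => /(_ isT); lra.
have [t1|t1] := leP t (d (2 * k + 1)%N).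
  apply: le_trans (in1 t _) _; first by rewrite dt.
  by rewrite ler_wpM2r // ler_expR; lra.
have [_ H] := Hv k t; apply: le_trans (H _) _; first by rewrite (ltW t1).
rewrite [B + _]addrC (expRD (growth p q K eta)) -[leRHS]mulrA.
apply: ler_pM; rewrite ?expR_ge0 //.
  rewrite ler_expR; have h : t - d (2 * k + 1)%N <= eta.
    by apply: le_trans hs; rewrite /dwell2 lerD2r.
  have := growth_gap K1 pq h.
  have : 0 <= q * (eta - (t - d (2 * k + 1)%N)).
    by rewrite mulr_ge0 ?subr_ge0 // ltW.
  lra.
by apply: in1; rewrite lexx andbT; apply: dm; lia.
Qed.

(** If the total gain were finite, the gains would tend to 0, and the dwell
    times to (tau, eta) by [gain_ge]. *)
Lemma gain_diverges n p q K tau eta sigma d : 0 < q -> 1 <= K -> p <= q ->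
  0 < tau -> decay n tau = growth p q K eta -> 0 < growth p q K eta ->
  dwell_bounds tau eta sigma d ->
  ~ ((dwell1 d k, dwell2 d k) @[k --> \oo] --> ((tau, eta) : R * R)) ->
  series (gain n p q K d) @ \oo --> +oo.
Proof.
move=> q0 K1 pq tau0 tauE G0 db ncvg.
have [_ _ hd] := db.
have gk k := gain_ge k q0 K1 pq tau0 tauE db.
set c := growth p q K eta / tau in gk.
have c0 : 0 < c by rewrite divr_gt0.
have t0 k : 0 <= c * (dwell1 d k - tau).
  by have [h _] := hd k; rewrite mulr_ge0 ?subr_ge0 // ltW.
have s0 k : 0 <= q * (eta - dwell2 d k).
  by have [_ h] := hd k; rewrite mulr_ge0 ?subr_ge0 // ltW.
apply: nondecreasing_dvgn_lt.
  apply/nondecreasing_seqP => k; rewrite seriesSr lerDl.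
  by apply: le_trans (gk k); rewrite addr_ge0.
move=> /cvg_series_cvg_0 g0; apply: ncvg.
apply: (@cvg_pair _ _ _ _ (nbhs tau) (nbhs eta)) => /=.
  have : c^-1 * gain n p q K d k @[k --> \oo] --> c^-1 * 0.
    by apply: cvgM => //; exact: cvg_cst.
  rewrite mulr0 => h.
  apply/subr_cvg0; apply: squeeze_cvgr (cvg_cst 0) h.
  apply: nearW => k; have [tk _] := hd k; rewrite subr_ge0 tk /=.
  rewrite ler_pdivlMl //; have := gk k; have := s0 k; lra.
have : eta - q^-1 * gain n p q K d k @[k --> \oo] --> eta - q^-1 * 0.
  by apply: cvgB; [exact: cvg_cst|apply: cvgM => //; exact: cvg_cst].
rewrite mulr0 subr0 => h.
apply: squeeze_cvgr h (cvg_cst eta).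
apply: nearW => k; have [_ sk] := hd k; rewrite sk andbT.
rewrite lerBlDr -lerBlDl ler_pdivlMl //; have := gk k; have := t0 k; lra.
Qed.

End Switching.

(** * Stability *)

Section Stability.
Context {R : realType}.
Implicit Types (n p q K B tau eta : R) (sigma : R -> mode) (d : nat -> R).

Lemma solution_cycle_bounded (A1 A2 Q N : 'M[R]_2) n p q K tau eta sigma d x :
  p <= q -> \det N ^+ 2 = 1 ->
  1 + (N 0 0 * N 1 0 + N 0 1 * N 1 1) ^+ 2 = K ->
  invmx Q *m A1 = mx22 (- n) 1 0 (- n) *m invmx Q ->
  N *m invmx Q *m A2 = mx22 p 0 0 q *m (N *m invmx Q) ->
  dwell_bounds tau eta sigma d -> solution A1 A2 sigma x ->
  cycle_bounded n p q K d (fun t => enorm (invmx Q *m x t)).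
Proof.
move=> pq detN KE QA1 NA2 [sw s0 _] sol k t.
have [m1 m2] := switching_modes k sw s0.
split=> /andP[dt td].
  have tr : trajectory A1 x (d (2 * k)%N) t.
    have -> : A1 = subsystem A1 A2 (sigma (d (2 * k)%N)) by rewrite m1.
    by apply: solution_trajectory sw sol _; rewrite dt -addn1.
  by rewrite (jordan_flow dt QA1 tr) enorm_jordan_flow // subr_ge0.
have tr : trajectory A2 x (d (2 * k + 1)%N) t.
  have -> : A2 = subsystem A1 A2 (sigma (d (2 * k + 1)%N)) by rewrite m2.
  by apply: solution_trajectory sw sol _; rewrite dt -addn1 -addnA.
have uN : N \in unitmx by rewrite unitmxE unitfE -sqrf_eq0 detN oner_eq0.
have -> : invmx Q *m x t = invmx N *m (N *m invmx Q *m x t).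
  by rewrite -mulmxA mulKmx.
rewrite (diagonal_flow dt NA2 tr) -[N *m _ *m _]mulmxA.
by apply: enorm_diagonal_flow; rewrite ?subr_ge0.
Qed.

(** The constant absorbs the change of coordinates and the possible growth
    inside a cycle. *)
Lemma solution_estimate (A1 A2 Q N : 'M[R]_2) n p q K tau eta sigma d :
  0 < n -> 0 < q -> p <= q -> 0 < tau -> 0 < eta ->
  Q \in unitmx -> \det N ^+ 2 = 1 ->
  1 + (N 0 0 * N 1 0 + N 0 1 * N 1 1) ^+ 2 = K ->
  invmx Q *m A1 = mx22 (- n) 1 0 (- n) *m invmx Q ->
  N *m invmx Q *m A2 = mx22 p 0 0 q *m (N *m invmx Q) ->
  decay n tau = growth p q K eta ->
  dwell_bounds tau eta sigma d ->
  exists2 C, 0 < C & forall x, solution A1 A2 sigma x ->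
    forall k t, d (2 * k)%N <= t ->
    enorm (x t) <= C * expR (- series (gain n p q K d) k) * enorm (x 0).
Proof.
move=> n0 q0 pq tau0 eta0 uQ detN KE QA1 NA2 tauE db.
have [sw _ hd] := db; have [d0 _ _ _ _] := sw.
have dm := switching_times_ndecr sw.
have K1 : 1 <= K by rewrite -KE lerDl sqr_ge0.
have G0 : 0 <= growth p q K eta.
  have := growth_gap K1 pq (ltW eta0); rewrite growth0 !subr0.
  by apply: le_trans; rewrite mulr_ge0 ?ltW.
have gain0 k : 0 <= gain n p q K d k.
  have [ht hs] := hd k.
  apply: le_trans (gain_ge k q0 K1 pq tau0 tauE db).
  by rewrite addr_ge0 // mulr_ge0 ?divr_ge0 ?subr_ge0 // ltW.
have [B B0 HB] := decay_ge_linear n0.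
have {}HB s : 0 <= s -> - B <= decay n s.
  move=> sge0; apply: le_trans (HB s sge0).
  by rewrite lerDr mulr_ge0 // divr_ge0 // ltW.
have [C1 C10 HC1] := enorm_mulmx_bounded Q.
have [C2 C20 HC2] := enorm_mulmx_bounded (invmx Q).
pose E := expR (B + growth p q K eta).
have E0 : 0 < E by exact: expR_gt0.
exists (C1 * E * C2); first by rewrite !mulr_gt0.
move=> x sol k t dt.
have cb := solution_cycle_bounded pq detN KE QA1 NA2 db sol.
have t0 : 0 <= t by apply: le_trans dt; exact: switching_times_ge0 sw.
have [j /andP[djt tdj]] := cycle_of_time sw t0.
have kj : (k <= j)%N.
  rewrite leqNgt; apply/negP => jk.
  have : d (2 * j + 2)%N <= d (2 * k)%N by apply: dm; rewrite -mulnSr leq_mul2l.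
  by move=> /(lt_le_trans tdj) /lt_le_trans /(_ dt); rewrite ltxx.
have [_ hs] := hd j.
have within := norm_within_cycle q0 K1 pq HB G0 dm hs cb
  (fun s => enorm_ge0 _).
have at_j := norm_at_cycle j cb dm; rewrite d0 in at_j.
have Sjk : series (gain n p q K d) k <= series (gain n p q K d) j.
  have := @nondecreasing_series R (gain n p q K d) xpredT 0.
  by apply=> // i _ _; exact: gain0.
have -> : x t = Q *m (invmx Q *m x t) by rewrite mulKVmx.
apply: le_trans (HC1 _) _; rewrite -!mulrA ler_pM2l //.
apply: le_trans (within t _) _; first by rewrite djt ltW.
rewrite -/E ler_pM2l //; apply: le_trans at_j _.
rewrite mulrCA; apply: ler_pM; rewrite ?expR_ge0 ?enorm_ge0 //.
by rewrite ler_expR lerN2.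
Qed.

Lemma asymptotic_of_estimate (v : R -> R) (S : nat -> R) (e : nat -> R) C :
  0 <= C -> (forall t, 0 <= v t) ->
  (forall k t, e k <= t -> v t <= C * expR (- S k)) ->
  S @ \oo --> +oo -> v t @[t --> +oo] --> 0.
Proof.
move=> C0 v0 ve Sy; apply/cvgrPdist_lt => eps eps0.
have [k _ Hk] : \forall k \near \oo, ln ((1 + C) / eps) < S k.
  by move/cvgryPgt : Sy; exact.
have C1 : 0 < (1 + C) / eps by rewrite divr_gt0 //; lra.
near=> t; rewrite sub0r normrN ger0_norm //.
apply: (@le_lt_trans _ _ (C * expR (- S k))).
  by apply: ve; near: t; apply: nbhs_pinfty_ge; exact: num_real.
apply: (@le_lt_trans _ _ (C * (eps / (1 + C)))).
  rewrite ler_wpM2l // -invf_div -[(1 + C) / eps]lnK ?posrE // -expRN.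
  by rewrite ler_expR lerN2 ltW //; exact: (Hk k (leqnn k)).
by rewrite mulrA ltr_pdivrMr; nra.
Unshelve. all: by end_near. Qed.

Lemma intertwining_inv (A Q J : 'M[R]_2) : Q \in unitmx ->
  A *m Q = Q *m J -> invmx Q *m A = J *m invmx Q.
Proof.
by move=> uQ AQ; rewrite -[LHS](mulmxK uQ) -[_ *m A *m Q]mulmxA AQ mulKmx.
Qed.

End Stability.

Theorem theorem10p1 (R : realType) (A1 A2 P1 P2 : 'M[R]_2)
  (n1 p2 q2 eta : R)
  (hP1 : P1 \in unitmx) (hP2 : P2 \in unitmx)
  (hA1 : A1 = P1 *m mx22 (- n1) 1 0 (- n1) *m invmx P1)
  (hA2 : A2 = P2 *m mx22 p2 0 0 q2 *m invmx P2)
  (hn1 : 0 < n1)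
  (hpq : 0 < p2 <= q2 \/ p2 <= 0 < q2)
  (hdet : \det (invmx P2 *m P1) = 1 \/ \det (invmx P2 *m P1) = - 1)
  (heta : 0 < eta) :
  let M := invmx P2 *m P1 in
  let a := M 0 0 in
  let c := M 1 0 in
  let r := Num.max (2 * `|a * c|) 1 in
  let K := 1 / 4 * (r^-1 + r) ^+ 2 in
  (exists! tau : R, is_tau12 n1 p2 q2 eta K tau) /\
  forall tau : R, is_tau12 n1 p2 q2 eta K tau ->
    (forall sigma, signals tau eta sigma -> stable A1 A2 sigma) /\
    (forall sigma, signals' tau eta sigma -> asymptotically_stable A1 A2 sigma).
Proof.
move=> M a c r K.
have q0 : 0 < q2 by case: hpq => /andP[]; lra.
have pq : p2 <= q2 by case: hpq => /andP[]; lra.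
have detM : \det M ^+ 2 = 1.
  by rewrite /M; case: hdet => ->; rewrite ?sqrrN expr1n.
have detME : (M 0 0 * M 1 1 - M 0 1 * M 1 0) ^+ 2 = 1.
  by rewrite -det_mx22E.
have [be beE] := optimal_shear detME.
pose T : 'M[R]_2 := mx22 1 be 0 1.
have detT : \det T = 1 by rewrite det_mx22E !mx22E; ring.
pose Q := P1 *m T; pose N := M *m T.
have uQ : Q \in unitmx by rewrite unitmx_mul hP1 unitmxE detT unitr1.
have detN : \det N ^+ 2 = 1 by rewrite det_mulmx detT mulr1.
have KE : 1 + (N 0 0 * N 1 0 + N 0 1 * N 1 1) ^+ 2 = K.
  rewrite /K /r /a /c -beE !mulmx22E !mx22E.
  by congr (1 + _ ^+ 2); ring.
have K1 : 1 <= K by rewrite -KE lerDl sqr_ge0.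
have QA1 : invmx Q *m A1 = mx22 (- n1) 1 0 (- n1) *m invmx Q.
  apply: intertwining_inv => //; rewrite hA1 /Q -!mulmxA mulKmx //.
  congr (_ *m _); apply/matrixP => i j; rewrite !mulmx22E.
  by have [->|->] := ord2_cases i; have [->|->] := ord2_cases j;
    rewrite !mx22E; ring.
have NQ : N *m invmx Q = invmx P2.
  by rewrite (_ : N = invmx P2 *m Q) ?mulmxK // mulmxA.
have NA2 : N *m invmx Q *m A2 = mx22 p2 0 0 q2 *m (N *m invmx Q).
  by rewrite NQ hA2 -!mulmxA mulKmx.
have G0 : 0 < growth p2 q2 K eta.
  have := growth_gap K1 pq (ltW heta); rewrite growth0 !subr0.
  by apply: lt_le_trans; rewrite mulr_gt0.
have tauP t : is_tau12 n1 p2 q2 eta K t <->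
    0 < t /\ decay n1 t = growth p2 q2 K eta.
  rewrite /is_tau12 -/(growth p2 q2 K eta).
  by split=> -[t0 <-]; split=> //; rewrite decayE // ltW.
have est tau sigma d : is_tau12 n1 p2 q2 eta K tau ->
    dwell_bounds tau eta sigma d ->
    exists2 C, 0 < C & forall x, solution A1 A2 sigma x ->
      forall k t, d (2 * k)%N <= t ->
      enorm (x t) <= C * expR (- series (gain n1 p2 q2 K d) k) * enorm (x 0).
  move=> /tauP[tau0 tauE] db.
  exact: (solution_estimate hn1 q0 pq tau0 heta uQ
    detN KE QA1 NA2 tauE db).
have stab tau sigma d : is_tau12 n1 p2 q2 eta K tau ->
    dwell_bounds tau eta sigma d -> stable A1 A2 sigma.
  move=> tauH db eps eps0; have [C C0 HC] := est _ _ _ tauH db.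
  exists (eps / C); first by rewrite divr_gt0.
  move=> x sol x0 t t0; have [[d0 _ _ _ _] _ _] := db.
  have := HC x sol 0%N t; rewrite muln0 d0 (ltW t0) => /(_ isT).
  rewrite seriesEnat /= big_geq // oppr0 expR0 mulr1 => /le_lt_trans; apply.
  by rewrite mulrC -ltr_pdivlMr.
split.
  have [t [t1 t2]] := decay_unique_level hn1 G0.
  by exists t; split=> [|s /tauP]; [apply/tauP|exact: t2].
move=> tau tauH; split=> [sigma [d db]|sigma [d db ncvg]].
  exact: stab tauH db.
split; first exact: stab tauH db.
move=> x sol; have [C C0 HC] := est _ _ _ tauH db.
have /tauP[tau0 tauE] := tauH.
apply: (@asymptotic_of_estimate R _ (series (gain n1 p2 q2 K d))
  (fun k => d (2 * k)%N) (C * enorm (x 0))).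
- by rewrite mulr_ge0 ?enorm_ge0 // ltW.
- by move=> t; exact: enorm_ge0.
- by move=> k t dt; rewrite mulrAC; exact: HC.
- exact: gain_diverges q0 K1 pq tau0 tauE G0 db ncvg.
Qed.
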